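(* Let $q$ be a prime power and let $F$ be an arrangement of $q+1$ distinct lines in $\mathbb{F}_q^2$. Suppose there exists an arrangement $A$ of $q+1$ distinct lines in $\mathbb{R}^2$ such that $x_i(A)=x_i(F)$ for all $i\in\{2,\dots,q+1\}$. Then \[f_1^b(A)=(q+1)(q-1)-x_1(F)\qquad\text{and}\qquad f_2^b(A)=x_0(F).\]
   Context: For an arrangement $F$ of lines in $\mathbb{F}_q^2$ and $i\ge 0$, $x_i(F)$ is the number of points of $\mathbb{F}_q^2$ lying on exactly $i$ lines of $F$. For an arrangement $A$ of lines in $\mathbb{R}^2$ and $i\ge 2$, $x_i(A)$ is the number of points of $\mathbb{R}^2$ lying on exactly $i$ lines of $A$. The lines of $A$ decompose $\mathbb{R}^2$ into cells: $0$-dimensional cells (vertices, i.e. intersection points), $1$-dimensional cells (edges) and $2$-dimensional cells (faces); $f_1^b(A)$ is the number of bounded $1$-dimensional cells and $f_2^b(A)$ the number of bounded $2$-dimensional cells of $A$. *)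

(* Defs.v *)
From HB Require Import structures.
From mathcomp Require Import all_boot all_order all_algebra finmap.
From mathcomp Require Import all_classical all_reals all_analysis.
From mathcomp Require Import ring lra.

Set Implicit Arguments.
Unset Strict Implicit.
Unset Printing Implicit Defensive.

Import Order.TTheory GRing.Theory Num.Theory numFieldNormedType.Exports.

Local Open Scope classical_set_scope.
Local Open Scope card_scope.
Local Open Scope ring_scope.

(* Junk value 0 on infinite sets. points_on_finite, edges_finite and
   faces_finite below show it never arises over the reals, except for x_ 0 and
   x_ 1, which are only meant over a finite field. *)
Definition ncard (T : choiceType) (S : set T) : nat := #|` fset_set S|.

Definition is_line (K : fieldType) (l : set (K * K)) : Prop :=
  exists a b c : K, (a, b) <> (0, 0) /\
    l = [set p | a * p.1 + b * p.2 = c].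

Definition arrangement (K : fieldType) (n : nat) (A : set (set (K * K))) :
    Prop :=
  A #= `I_n /\ A `<=` @is_line K.

Definition points_on (K : fieldType) (i : nat) (A : set (set (K * K))) :
    set (K * K) :=
  [set p | [set l | A l /\ l p] #= `I_i].

Definition x_ (K : fieldType) (i : nat) (A : set (set (K * K))) : nat :=
  ncard (points_on i A).

Section Cells.
Variable R : realType.
Implicit Type A : set (set (R * R)).

Definition vertices A : set (R * R) :=
  [set p | exists l m, [/\ A l, A m, l <> m, l p & m p]].

Definition components (X : set (R * R)) : set (set (R * R)) :=
  [set connected_component X p | p in X].

Definition edges A : set (set (R * R)) :=
  \bigcup_(l in A) components (l `\` vertices A).

Definition faces A : set (set (R * R)) :=
  components (~` \bigcup_(l in A) l).

Definition f1b A : nat := ncard (edges A `&` bounded_set).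

Definition f2b A : nat := ncard (faces A `&` bounded_set).

End Cells.

Section Finiteness.
Variable R : realType.
Implicit Types (A B : set (set (R * R))) (p q : R * R).

Lemma is_line_neq_finiteI (l m : set (R * R)) :
  is_line l -> is_line m -> l <> m -> finite_set (l `&` m).
Proof.
move=> [a [b [c [ab ->]]]] [a' [b' [c' [ab' ->]]]] lm.
have [d0|d0] := eqVneq (a * b' - a' * b) 0.
  suff -> : [set p | a * p.1 + b * p.2 = c] `&`
            [set p : R * R | a' * p.1 + b' * p.2 = c'] = set0 by [].
  rewrite -subset0 => -[u v] /= [e e']; apply: lm.
  have [k [k0 [ea eb]]] : exists k, k != 0 /\ a' = k * a /\ b' = k * b.
    have [a0|a0] := eqVneq a 0.
      have b0 : b != 0 by apply/eqP => b0; apply: ab; rewrite a0 b0.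
      have a'0 : a' = 0.
        by move/eqP: d0; rewrite a0 mul0r sub0r oppr_eq0 mulf_eq0 (negPf b0)
          orbF => /eqP.
      exists (b' / b); split; last by rewrite a0 mulr0 divfK.
      rewrite mulf_neq0 ?invr_eq0//; apply/eqP => b'0.
      by apply: ab'; rewrite a'0 b'0.
    exists (a' / a); split; last first.
      split; first by rewrite divfK.
      by apply: (mulfI a0); rewrite mulrA mulrCA divff// mulr1; lra.
    rewrite mulf_neq0 ?invr_eq0//; apply/eqP => a'0; apply: ab'.
    move/eqP: d0; rewrite a'0 mul0r subr0 mulf_eq0 (negPf a0) => /= /eqP b'0.
    by rewrite b'0.
  have ec : c' = k * c by rewrite -e -e' ea eb mulrDr !mulrA.
  apply/seteqP; split=> -[s t] /=; rewrite ea eb ec -!mulrA -mulrDr.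
    by move=> ->.
  by move/(mulfI k0).
apply: (@sub_finite_set _ _ [set ((c * b' - c' * b) / (a * b' - a' * b),
   (a * c' - a' * c) / (a * b' - a' * b))]); last exact: finite_set1.
move=> [u v] /= [e e']; congr pair; apply: (mulIf d0);
  rewrite divfK// -e -e'; ring.
Qed.

Lemma vertices_finite n A : arrangement n A -> finite_set (vertices A).
Proof.
move=> [An Al].
have Af : finite_set A by exists n.
apply: (@sub_finite_set _ _ (\bigcup_(l in A)
   \bigcup_(m in [set m | A m /\ l <> m]) (l `&` m))).
  by move=> p [l [m [Ap Am lm lp mp]]]; exists l => //; exists m.
apply: bigcup_finite => // l lA; apply: bigcup_finite.
  by apply: sub_finite_set Af => m [].
by move=> m [mA lm]; apply: is_line_neq_finiteI => //; exact: Al.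
Qed.

Lemma points_on_finite n A i : arrangement n A -> (2 <= i)%N ->
  finite_set (points_on i A).
Proof.
move=> An i2; apply: sub_finite_set (vertices_finite An) => p /= pi.
have /card_set_bijP[f [fA fi _]] : `I_i #= [set l | A l /\ l p].
  by rewrite card_eq_sym.
have i0 : `I_i 0%N by exact: ltn_trans i2.
have i1 : `I_i 1%N by [].
have [[A0 p0] [A1 p1]] := (fA _ i0, fA _ i1).
exists (f 0%N), (f 1%N); split => // /fi.
by rewrite !inE => /(_ i0 i1).
Qed.

Definition convex_subset (L : set (R * R)) : Prop :=
  forall p q (t : R), L p -> L q -> 0 <= t <= 1 -> L (p + t *: (q - p)).

Lemma components_finite (L : set (R * R)) B :
  convex_subset L -> finite_set B -> B `<=` @is_line R ->
  finite_set (components (L `\` \bigcup_(l in B) l)).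
Proof.
move=> Lc Bf Bl; set X := _ `\` _.
have [h hP] : exists h : set (R * R) -> R * R * R, forall l, B l ->
    l = [set p | (h l).1.1 * p.1 + (h l).1.2 * p.2 = (h l).2].
  have : forall l, exists k : R * R * R, B l ->
      l = [set p | k.1.1 * p.1 + k.1.2 * p.2 = k.2].
    move=> l; have [/Bl [a [b [c [_ e]]]]|?] := pselect (B l).
      by exists (a, b, c) => _; exact: e.
    by exists (0, 0, 0).
  by move=> /boolp.choice[h hP]; exists h.
pose g l p : R := (h l).1.1 * p.1 + (h l).1.2 * p.2 - (h l).2.
have gP l p : B l -> l p <-> g l p = 0.
  move=> lB; rewrite {1}(hP l lB) /g /=; split => [->|/eqP]; first by rewrite subrr.
  by rewrite subr_eq0 => /eqP.
pose s p := [fset l in fset_set B | 0 < g l p]%fset.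
pose rep S := xget (0 : R * R) [set p | X p /\ s p = S].
apply: (@sub_finite_set _ _
    [set connected_component X (rep S) | S in [set` fpowerset (fset_set B)]]);
  last exact/finite_image/finite_fset.
move=> _ [p pX <-]; exists (s p).
  by rewrite /= fpowersetE; apply/fsubsetP => l; rewrite !inE => /andP[].
have [rX rs] : X (rep (s p)) /\ s (rep (s p)) = s p.
  exact: (@xgetPex _ 0 [set q | X q /\ s q = s p] (ex_intro _ p (conj pX erefl))).
move: (rep (s p)) rX rs => q qX qs.
pose f (t : R) : R * R := p + t *: (q - p).
have fc : connected (f @` `[0, 1]).
  apply: connected_continuous_connected; first exact: segment_connected.
  apply: continuous_subspaceT => t.
  by apply: cvgD; [exact: cvg_cst|apply: cvgZr_tmp; exact: cvg_id].
have fX : f @` `[0, 1] `<=` X.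
  move=> _ [t /= + <-]; rewrite in_itv/= => t01; split.
    by apply: Lc => //; [case: pX|case: qX].
  move=> [l lB /(gP _ _ lB) gf].
  have gp0 : g l p != 0.
    by apply/eqP => /(gP _ _ lB) lp; case: pX => _; apply; exists l.
  have gq0 : g l q != 0.
    by apply/eqP => /(gP _ _ lB) lq; case: qX => _; apply; exists l.
  have sgE : (0 < g l q) = (0 < g l p).
    have : (l \in s q) = (l \in s p) by rewrite qs.
    by rewrite !inE in_fset_set// mem_set.
  have gE : g l (f t) = (1 - t) * g l p + t * g l q.
    have f1 : (f t).1 = p.1 + t * (q.1 - p.1) by [].
    have f2 : (f t).2 = p.2 + t * (q.2 - p.2) by [].
    by rewrite /g f1 f2; ring.
  move: gf; rewrite gE => {gE}; move: t01 => /andP[t0 t1].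
  case: (ltrgtP 0 (g l p)) sgE gp0 gq0 => [p0|p0|_] //.
    move=> q0 _ _; nra.
  case: ltrgtP => // q0 _ _ _; nra.
apply/esym/same_connected_component.
exists (f @` `[0, 1]).
  split => //.
    by exists 0; rewrite ?/f ?scale0r ?addr0//= in_itv/= lexx ler01.
by exists 1; rewrite ?/f ?scale1r ?subrKC//= in_itv/= lexx ler01.
Qed.

Lemma edges_finite n A : arrangement n A -> finite_set (edges A).
Proof.
move=> [An Al]; have Af : finite_set A by exists n.
apply: bigcup_finite => // l lA.
have -> : l `\` vertices A = l `\` \bigcup_(m in A `\ l) m.
  apply/seteqP; split => p [lp nv]; split => //.
    by move=> [m [mA /= ml] mp]; apply: nv; exists l, m; split => // /esym.
  move=> [m [m' [mA m'A mm' mp m'p]]]; apply: nv.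
  have [ml|ml] := pselect (m = l); last by exists m.
  by exists m' => //; split => // m'l; apply: mm'; rewrite ml m'l.
apply: components_finite.
- have [a [b [c [_ ->]]]] := Al _ lA.
  move=> p q t /= ep eq _.
  change (a * (p.1 + t * (q.1 - p.1)) + b * (p.2 + t * (q.2 - p.2)) = c).
  transitivity ((1 - t) * (a * p.1 + b * p.2) + t * (a * q.1 + b * q.2)).
    by ring.
  by rewrite ep eq; ring.
- by apply: sub_finite_set Af => m [].
- by move=> m [/Al].
Qed.

Lemma faces_finite n A : arrangement n A -> finite_set (faces A).
Proof.
move=> [An Al]; rewrite /faces -setTD; apply: components_finite => //.
by exists n.
Qed.

End Finiteness.

(* Main.v *)
Require Import Defs.
From HB Require Import structures.
From mathcomp Require Import all_boot all_order all_algebra finmap.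
From mathcomp Require Import all_classical all_reals all_analysis.
From mathcomp Require Import ring lra zify.

Set Implicit Arguments.
Unset Strict Implicit.
Unset Printing Implicit Defensive.

Import Order.TTheory GRing.Theory Num.Theory numFieldNormedType.Exports.

Local Open Scope classical_set_scope.
Local Open Scope card_scope.
Local Open Scope ring_scope.

(* Adding a line to a real arrangement that is not a pencil of parallels creates
   exactly one new bounded face per bounded edge on the new line: a bounded edge
   either cuts a bounded face in two, or cuts a bounded piece off an unbounded
   face, while a ray separates unbounded faces. The same holds one dimension
   lower for points added to a line, so a line with v > 0 vertices has v - 1
   bounded edges. Hence for n lines, with i(P) the number of lines through P,
     f_1^b = sum_P i(P) - n  and  f_2^b = 1 - n + sum_P (i(P) - 1),
   where P runs over the vertices. Over F_q, counting points and incidences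
   gives sum_i x_i = q^2 and sum_i i x_i = q (q + 1), and the result follows.

   Cells are handled as lists of strict affine inequalities; a nonempty cell is
   bounded iff it has no nonzero recession direction. *)

(** * Cells cut out by affine equations and strict inequalities *)

Section Cells.
Variable R : realType.
Implicit Types (e g h : R * R * R) (p d : R * R) (hs gs c : seq (R * R * R)).

(* A triple (a, b, c) stands for the affine form (x, y) |-> a x + b y - c. *)
Definition affine_val e p : R := e.1.1 * p.1 + e.1.2 * p.2 - e.2.
Definition affine_dir e d : R := e.1.1 * d.1 + e.1.2 * d.2.
Definition affine_opp e : R * R * R := (- e.1.1, - e.1.2, - e.2).

(** Keeping the equations [hs] apart from the inequalities [c] lets one recursion treat faces (no
    equation), edges (one) and vertices (two crossing forms). *)
Definition cell hs c : set (R * R) :=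
  [set p | all (fun h => affine_val h p == 0) hs &&
           all (fun e => 0 < affine_val e p) c].

(** The recession cone: inequalities become weak, since a direction along which a form is constant
    preserves its strict positivity. *)
Definition recession hs c d : bool :=
  all (fun h => affine_dir h d == 0) hs && all (fun e => 0 <= affine_dir e d) c.

Lemma affine_val_move e p d t :
  affine_val e (p + t *: d) = affine_val e p + t * affine_dir e d.
Proof.
rewrite /affine_val /affine_dir.
have -> : (p + t *: d).1 = p.1 + t * d.1 by [].
have -> : (p + t *: d).2 = p.2 + t * d.2 by [].
ring.
Qed.

Lemma affine_val_segment e p q t : affine_val e (p + t *: (q - p)) =
  (1 - t) * affine_val e p + t * affine_val e q.
Proof.
rewrite /affine_val.
have -> : (p + t *: (q - p)).1 = p.1 + t * (q.1 - p.1) by [].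
have -> : (p + t *: (q - p)).2 = p.2 + t * (q.2 - p.2) by [].
ring.
Qed.

Lemma affine_val_opp e p : affine_val (affine_opp e) p = - affine_val e p.
Proof. rewrite /affine_val /=; ring. Qed.

Lemma affine_dir_opp e d : affine_dir (affine_opp e) d = - affine_dir e d.
Proof. rewrite /affine_dir /=; ring. Qed.

Lemma affine_dirD e d d' : affine_dir e (d + d') = affine_dir e d + affine_dir e d'.
Proof.
rewrite /affine_dir.
have -> : (d + d').1 = d.1 + d'.1 by [].
have -> : (d + d').2 = d.2 + d'.2 by [].
ring.
Qed.

Lemma affine_dirZ e t d : affine_dir e (t *: d) = t * affine_dir e d.
Proof.
rewrite /affine_dir.
have -> : (t *: d).1 = t * d.1 by [].
have -> : (t *: d).2 = t * d.2 by [].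
ring.
Qed.

Lemma affine_val_continuous e : continuous (affine_val e).
Proof.
move=> p; apply: cvgB; last exact: cvg_cst.
by apply: cvgD; apply: cvgM; try exact: cvg_cst; [exact: cvg_fst|exact: cvg_snd].
Qed.

Lemma affine_dir_continuous e : continuous (affine_dir e).
Proof.
move=> p.
by apply: cvgD; apply: cvgM; try exact: cvg_cst; [exact: cvg_fst|exact: cvg_snd].
Qed.

(** * Boundedness and recession directions *)

Lemma cell_recession hs c p d t : recession hs c d -> cell hs c p -> 0 <= t ->
  cell hs c (p + t *: d).
Proof.
move=> /andP[/allP dh /allP dc] /andP[/allP ph /allP pc] t0.
apply/andP; split; apply/allP => e es; rewrite affine_val_move.
  by rewrite (eqP (dh _ es)) (eqP (ph _ es)) mulr0 addr0.
by rewrite ltr_wpDr ?pc// mulr_ge0// dc.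
Qed.

Lemma bounded_recession hs c d : cell hs c !=set0 -> bounded_set (cell hs c) ->
  recession hs c d -> d = 0.
Proof.
move=> [p Cp] [M [_ MC]] rd; have [//|dn0] := eqVneq d 0.
have d0 : 0 < `|d| by rewrite normr_gt0.
(* This [t] gives [t *: d] norm [|M| + 2 + |p|], whereas a point of the cell, of norm at most
   [|M| + 1], allows only [|M| + 1 + |p|]. *)
pose t := (`|M| + 2 + `|p|) / `|d|.
have t0 : 0 <= t by rewrite divr_ge0// !addr_ge0.
have MM : M < `|M| + 1 by rewrite (le_lt_trans (ler_norm M))// ltrDl.
have H1 : `|p + t *: d| <= `|M| + 1 := MC _ MM _ (cell_recession rd Cp t0).
have : `|t *: d| <= `|p + t *: d| + `|p|.
  by rewrite -{1}[t *: d](addKr p) addrC (le_trans (ler_normB _ _)).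
by rewrite normrZ (ger0_norm t0) {1}/t divfK ?gt_eqF// => ?; exfalso; lra.
Qed.

Lemma sum_continuous (T : Type) (s : seq T) (F : T -> R * R -> R) :
  (forall x, continuous (F x)) -> continuous (fun d => \sum_(x <- s) F x d).
Proof.
move=> Fc; elim: s => [|x s IHs] d.
  by under eq_fun do rewrite big_nil; exact: cvg_cst.
under eq_fun do rewrite big_cons.
by apply: cvgD; [exact: Fc|exact: IHs].
Qed.

(* The deficit [f] is continuous and positive on the compact unit sphere, hence
   bounded away from 0; a far away point of the cell would violate this. *)
Lemma recession_bounded hs c :
  (forall d, recession hs c d -> d = 0) -> bounded_set (cell hs c).
Proof.
move=> nr; have [[p0 Cp0]|C0] := pselect (cell hs c !=set0); last first.
  have -> : cell hs c = set0 by apply/seteqP; split => // p Cp; case: C0; exists p.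
  by exists 0; split => // M _ ?.
pose f d : R := \sum_(h <- hs) `|affine_dir h d| +
                \sum_(e <- c) (`|affine_dir e d| - affine_dir e d).
have fc : continuous f.
  move=> d; apply: cvgD; apply: sum_continuous => e {}d.
    by apply: cvg_norm; exact: affine_dir_continuous.
  by apply: cvgB; [apply: cvg_norm|]; exact: affine_dir_continuous.
have nrc : continuous (fun d : R * R => `|d|) by move=> d; exact: norm_continuous.
pose S : set (R * R) := [set d | `|d| = 1].
have cS : compact S.
  pose I : set R := `[-1, 1]%classic.
  apply: (@subclosed_compact _ S (I `*` I)).
  - have -> : S = (fun d : R * R => `|d|) @^-1` [set 1] by [].
    by apply: preimage_closed => // ; exact: closed_eq.
  - by apply: compact_setX; exact: segment_compact.
  - move=> [x y] /=; rewrite /S /= prod_normE /= => xy.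
    rewrite /setX /I /= !in_itv /= -!ler_norml -xy.
    by rewrite !le_max !lexx orbT.
have S0 : S !=set0.
  by exists (1, 0); rewrite /S /= prod_normE /= normr1 normr0 max_l.
have [d0 /set_mem Sd0 fmin] := compact_EVT_min S0 cS (continuous_subspaceT fc).
have fs1 d : 0 <= \sum_(h <- hs) `|affine_dir h d| by exact: sumr_ge0.
have fs2 d : 0 <= \sum_(e <- c) (`|affine_dir e d| - affine_dir e d).
  by apply: sumr_ge0 => e _; rewrite subr_ge0 ler_norm.
(* All summands of [f] are nonnegative, so a zero of [f] on the sphere would be a nonzero recession
   direction. *)
have f0 : 0 < f d0.
  rewrite lt_def addr_ge0// andbT; apply/negP; rewrite paddr_eq0// => /andP[].
  rewrite psumr_eq0// psumr_eq0; last by move=> e _; rewrite subr_ge0 ler_norm.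
  move=> /allP h0 /allP e0; have : d0 = 0.
    apply: nr; apply/andP; split; apply/allP => e es.
      by rewrite -normr_eq0; exact: h0.
    by have := e0 _ es; rewrite /= subr_eq0 => /eqP <-.
  by move=> d00; move: Sd0; rewrite /S /= d00 normr0 => /esym /eqP; rewrite oner_eq0.
(* [K] bounds [t * f d] whenever [p0 + t *: d] is in the cell: if a form has value [v] at [p0] and
   slope [s], then [v + t * s > 0] forces [t * (|s| - s) <= 2 * v]. *)
pose K := \sum_(e <- c) 2 * affine_val e p0.
exists (`|p0| + K / f d0); split => [|M KM p Cp]; first exact: num_real.
apply/ltW/(le_lt_trans _ KM).
rewrite -[p](subrK p0) addrC (le_trans (ler_normD _ _))// lerD2l.
have [->|pp0] := eqVneq p p0.
  rewrite subrr normr0 divr_ge0 ?(ltW f0)// /K big_seq sumr_ge0// => e es.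
  by move: Cp0 => /andP[_ /allP/(_ _ es)/ltW ?]; rewrite mulr_ge0.
pose t := `|p - p0|; have t0 : 0 < t by rewrite normr_gt0 subr_eq0.
pose d := t^-1 *: (p - p0).
have Sd : S d by rewrite /S /= normrZ gtr0_norm ?invr_gt0// mulVf// gt_eqF.
have pE : p = p0 + t *: d.
  by rewrite /d scalerA divff ?gt_eqF// scale1r addrC subrK.
rewrite -/t ler_pdivlMr// (@le_trans _ _ (t * f d))//.
  by rewrite ler_pM2l// fmin// mem_set.
rewrite /f big_seq_cond big1 ?add0r; last first.
  move=> h; rewrite andbT => hh; apply/eqP; rewrite normr_eq0.
  have [/andP[/allP/(_ _ hh) Ch _] /andP[/allP/(_ _ hh) Ch0 _]] := (Cp, Cp0).
  move: Ch; rewrite pE affine_val_move (eqP Ch0) add0r mulf_eq0.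
  by rewrite gt_eqF.
rewrite mulr_sumr /K big_seq [leRHS]big_seq ler_sum// => e es.
have [/andP[_ /allP/(_ _ es) Ce] /andP[_ /allP/(_ _ es) Ce0]] := (Cp, Cp0).
by move: Ce Ce0; rewrite pE affine_val_move; case: ger0P => ? ? ?; nra.
Qed.

(** * Cutting a cell along a line *)

Definition nonempty_bounded hs c : bool :=
  `[< cell hs c !=set0 /\ bounded_set (cell hs c) >].

Lemma nonempty_boundedE hs c : cell hs c !=set0 ->
  nonempty_bounded hs c = `[< forall d, recession hs c d -> d = 0 >].
Proof.
move=> C0; apply/asboolP/asboolP => [[_ Cb] d|nr]; first exact: bounded_recession.
by split=> //; exact: recession_bounded.
Qed.

Lemma nonempty_boundedF hs c d : recession hs c d -> d != 0 ->
  nonempty_bounded hs c = false.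
Proof.
move=> rd /eqP d0; apply/asboolP => -[C0 Cb]; apply: d0.
exact: (bounded_recession C0 Cb).
Qed.

(** Strict inequalities survive small moves, and [w] is tangent to the equations. *)
Lemma cell_open hs c p w : cell hs c p -> all (fun h => affine_dir h w == 0) hs ->
  exists2 r : R, 0 < r & forall t, `|t| <= r -> cell hs c (p + t *: w).
Proof.
move=> /andP[/allP ph pc] /allP wh.
suff [r r0 rP] : exists2 r : R, 0 < r & forall t, `|t| <= r ->
    all (fun e => 0 < affine_val e (p + t *: w)) c.
  exists r => // t tr; apply/andP; split; last exact: rP.
  apply/allP => h hh; rewrite affine_val_move.
  by rewrite (eqP (ph _ hh)) (eqP (wh _ hh)) mulr0 addr0.
elim: c pc => [_|e c IHc /= /andP[pe /IHc[r r0 rP]]]; first by exists 1.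
set v := affine_val e p in pe; set s := affine_dir e w.
have s0 : 0 < 2 * (`|s| + 1) by rewrite mulr_gt0// ltr_wpDl.
(* The factor 2 keeps the change of the form below [v]; the added 1 covers slope zero. *)
exists (Num.min r (v / (2 * (`|s| + 1)))); first by rewrite lt_min r0 divr_gt0.
move=> t; rewrite le_min => /andP[/rP -> +]; rewrite andbT ler_pdivlMr// => tv.
rewrite affine_val_move -/v -/s.
have : - (t * s) <= `|t| * `|s| by rewrite -normrM -normrN ler_norm.
have := normr_ge0 t; have := mulr_ge0 (normr_ge0 t) (normr_ge0 s).
by lra.
Qed.

(** By convexity, a segment joining points on the two sides would meet the zero set of [g] inside
    the cell. *)
Lemma cell_split hs c g : ~ (cell (g :: hs) c !=set0) ->
  cell hs (affine_opp g :: c) = set0 \/ cell hs (g :: c) = set0.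
Proof.
move=> C0; have [[p Cp]|] := pselect (cell hs (g :: c) !=set0); last first.
  by move=> /set0P/negP; rewrite negbK => /eqP; right.
left; apply/seteqP; split => // q Cq; case: C0.
move: Cp Cq => /andP[/allP ph /= /andP[pg /allP pc]].
move=> /andP[/allP qh /= /andP[qg /allP qc]].
rewrite affine_val_opp oppr_gt0 in qg.
pose u := affine_val g p; pose v := - affine_val g q.
have u0 : 0 < u by []. have v0 : 0 < v by rewrite oppr_gt0.
pose t := u / (u + v); have uv : 0 < u + v by rewrite addr_gt0.
have t0 : 0 < t by rewrite divr_gt0.
have t1 : 0 < 1 - t by rewrite subr_gt0 ltr_pdivrMr// mul1r ltrDl.
exists (p + t *: (q - p)); apply/andP; split => /=; last first.
  by apply/allP => e es; rewrite affine_val_segment addr_gt0// mulr_gt0 ?pc ?qc.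
apply/andP; split.
  rewrite affine_val_segment -[affine_val g q]opprK -/u -/v /t; apply/eqP; field.
  by rewrite gt_eqF.
by apply/allP => h hh; rewrite affine_val_segment (eqP (ph _ hh)) (eqP (qh _ hh)) !mulr0 addr0.
Qed.

(* If [g] cuts the cell in an unbounded piece, both halves are unbounded. If it
   cuts it in a bounded piece, both halves cannot be unbounded, since some
   nonnegative combination of their recession directions is parallel to [g]. *)
Lemma nonempty_bounded_split hs c g :
  (cell (g :: hs) c !=set0 ->
    exists2 w, all (fun h => affine_dir h w == 0) hs & affine_dir g w != 0) ->
  (forall d, all (fun h => affine_dir h d == 0) hs ->
    all (fun e => affine_dir e d == 0) c -> d = 0) ->
  (nonempty_bounded hs (g :: c) + nonempty_bounded hs (affine_opp g :: c) =
   nonempty_bounded hs c + nonempty_bounded (g :: hs) c)%N.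
Proof.
move=> trans pointed.
(* If [g] misses the cell, one half is empty and the other is the whole cell. *)
have [C0|C0] := pselect (cell (g :: hs) c !=set0); last first.
  have gn p : cell hs c p -> affine_val g p != 0.
    move=> /andP[ph pc]; apply/negP => pg; apply: C0; exists p.
    by rewrite /cell /= pg ph pc.
  have -> : nonempty_bounded (g :: hs) c = false by apply/asboolP => -[].
  have nb0 c' : cell hs c' = set0 -> nonempty_bounded hs c' = false.
    by move=> c'0; apply/asboolP; rewrite c'0 => -[[]].
  have [Cn|Cp] := cell_split C0.
    rewrite (nb0 _ Cn) addn0 /nonempty_bounded.
    suff -> : cell hs (g :: c) = cell hs c by rewrite addn0.
    apply/seteqP; split => p; first by rewrite /cell /= => /and3P[-> _ ->].
    move=> Cp; have := gn _ Cp; rewrite neq_lt => /orP[gp|gp].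
      have : cell hs (affine_opp g :: c) p.
        by move: Cp; rewrite /cell /= affine_val_opp oppr_gt0 gp.
      by rewrite Cn.
    by move: Cp; rewrite /cell /= gp.
  rewrite (nb0 _ Cp) add0n /nonempty_bounded.
  suff -> : cell hs (affine_opp g :: c) = cell hs c by rewrite addn0.
  apply/seteqP; split => p; first by rewrite /cell /= => /and3P[-> _ ->].
  move=> Cn; have := gn _ Cn; rewrite neq_lt => /orP[gp|gp].
    by move: Cn; rewrite /cell /= affine_val_opp oppr_gt0 gp.
  have : cell hs (g :: c) p by move: Cn; rewrite /cell /= gp.
  by rewrite Cp.
(* Small moves along [w] and against it from a point of the cut show that both halves are nonempty,
   so all four cells are governed by recession directions. *)
have [w wh wg] := trans C0; have [p Cp] := C0.
have Cp' : cell hs c p by move: Cp; rewrite /cell /= => /andP[/andP[_ ->]].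
have pg : affine_val g p = 0 by move: Cp; rewrite /cell /= => /andP[/andP[/eqP]].
have [r r0 rP] := cell_open Cp' wh.
have cellt t : `|t| <= r -> 0 < t * affine_dir g w ->
    cell hs (g :: c) (p + t *: w).
  move=> /rP; rewrite /cell /= affine_val_move pg add0r => /andP[-> ->] ->.
  by [].
have cellt' t : `|t| <= r -> t * affine_dir g w < 0 ->
    cell hs (affine_opp g :: c) (p + t *: w).
  move=> /rP; rewrite /cell /= affine_val_opp affine_val_move pg add0r oppr_gt0.
  by move=> /andP[-> ->] ->.
have Cpos : cell hs (g :: c) !=set0.
  move: wg; rewrite neq_lt => /orP[wg|wg].
    by exists (p + (- r) *: w); apply: cellt; rewrite ?normrN ?gtr0_norm//; nra.
  by exists (p + r *: w); apply: cellt; rewrite ?gtr0_norm//; nra.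
have Cneg : cell hs (affine_opp g :: c) !=set0.
  move: wg; rewrite neq_lt => /orP[wg|wg].
    by exists (p + r *: w); apply: cellt'; rewrite ?gtr0_norm//; nra.
  by exists (p + (- r) *: w); apply: cellt'; rewrite ?normrN ?gtr0_norm//; nra.
rewrite !nonempty_boundedE//; last by exists p.
have dec hs' c' : (`[< forall d, recession hs' c' d -> d = 0 >] = false) <->
    exists2 d, recession hs' c' d & d != 0.
  split=> [/asboolP/existsNP[d /not_implyP[rd /eqP d0]]|[d rd /eqP d0]].
    by exists d.
  by apply/asboolP => /(_ d rd).
(* Boundedness of the positive half, the negative half, the whole cell and the cut. The implications
   below exclude all truth values violating [b1 + b2 = b3 + b4]. *)
set b1 := `[< _ >]; set b2 := `[< _ >]; set b3 := `[< _ >]; set b4 := `[< _ >].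
have b41 : b4 = false -> b1 = false.
  move=> /dec[d]; rewrite /recession /= => /andP[/andP[/eqP dg dh] dc] d0.
  by apply/dec; exists d; rewrite // /recession /= dg dh dc lexx.
have b42 : b4 = false -> b2 = false.
  move=> /dec[d]; rewrite /recession /= => /andP[/andP[/eqP dg dh] dc] d0.
  by apply/dec; exists d; rewrite // /recession /= affine_dir_opp dg dh dc oppr0 lexx.
have b13 : b1 = false -> b3 = false.
  move=> /dec[d]; rewrite /recession /= => /and3P[dh _ dc] d0.
  by apply/dec; exists d; rewrite // /recession dh dc.
have b23 : b2 = false -> b3 = false.
  move=> /dec[d]; rewrite /recession /= => /and3P[dh _ dc] d0.
  by apply/dec; exists d; rewrite // /recession dh dc.
have b312 : b3 = false -> b1 = false \/ b2 = false.
  move=> /dec[d /andP[dh dc] d0].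
  have [dg|dg] := leP 0 (affine_dir g d); [left|right]; apply/dec; exists d => //.
    by rewrite /recession /= dg dh dc.
  by rewrite /recession /= affine_dir_opp oppr_ge0 (ltW dg) dh dc.
have b124 : b1 = false -> b2 = false -> b4 = false.
  move=> /dec[d]; rewrite /recession /= => /and3P[/allP dh dg /allP dc] d0.
  move=> /dec[d']; rewrite /recession /= affine_dir_opp oppr_ge0.
  move=> /and3P[/allP dh' dg' /allP dc'] d0'.
  apply/dec; have [dg0|dg0] := eqVneq (affine_dir g d) 0.
    exists d => //; rewrite /recession /= dg0 eqxx/=.
    by apply/andP; split; apply/allP.
  pose u := affine_dir g d; pose v := - affine_dir g d'.
  have u0 : 0 < u by rewrite lt_def dg0. have v0 : 0 <= v by rewrite oppr_ge0.
  exists (v *: d + u *: d').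
    rewrite /recession /= affine_dirD !affine_dirZ -/u -[affine_dir g d']opprK -/v.
    apply/andP; split; last first.
      apply/allP => e es; rewrite affine_dirD !affine_dirZ.
      by rewrite addr_ge0// mulr_ge0 ?(ltW u0) ?dc ?dc'.
    apply/andP; split; first by apply/eqP; ring.
    apply/allP => h hh; rewrite affine_dirD !affine_dirZ.
    by rewrite (eqP (dh _ hh)) (eqP (dh' _ hh)) !mulr0 addr0.
  (* If the combination vanished, then, as all its terms are nonnegative and [u] is positive, every
     form of [c] would vanish on [d'], forcing [d'] to be zero. *)
  apply/eqP => dd; move/eqP: d0'; apply; apply: pointed; first exact/allP.
  apply/allP => e es; have := congr1 (affine_dir e) dd.
  rewrite affine_dirD !affine_dirZ.
  have -> : affine_dir e 0 = 0 by rewrite /affine_dir /= !mulr0 addr0.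
  move: (dc _ es) (dc' _ es) => /= ed ed' H.
  have : u * affine_dir e d' <= 0 by have := mulr_ge0 v0 ed; lra.
  by rewrite pmulr_rle0// => ?; rewrite eq_le ed' andbT.
move: b41 b42 b13 b23 b312 b124.
case: b1; case: b2; case: b3; case: b4 => //= h1 h2 h3 h4 h5 h6;
  solve [by have := h1 erefl|by have := h2 erefl|by have := h3 erefl
        |by have := h4 erefl|by case: (h5 erefl)|by have := h6 erefl erefl].
Qed.

(** * Sign choices and crossing lines *)

Fixpoint sign_choices gs : seq (seq (R * R * R)) :=
  if gs is g :: gs' then
    [seq g :: c | c <- sign_choices gs'] ++
    [seq affine_opp g :: c | c <- sign_choices gs']
  else [:: [::]].

(** Inconsistent sign choices give empty cells, which are trivially bounded; [nonempty_bounded]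
    discards them. *)
Definition nbounded hs gs : nat := count (nonempty_bounded hs) (sign_choices gs).

Definition on g p : bool := affine_val g p == 0.

Definition crossing g h : bool := g.1.1 * h.1.2 - g.1.2 * h.1.1 != 0.

Definition proper_form g : bool := g.1 != 0.

(* For proper forms with distinct zero sets: parallel lines do not meet. *)
Definition cross_if_meet g h : Prop := forall p, on g p -> on h p -> crossing g h.

(** Cramer's rule; for parallel lines the value is junk, so uses are guarded by [crossing]. *)
Definition meeting_point g h : R * R :=
  let D := g.1.1 * h.1.2 - g.1.2 * h.1.1 in
  ((g.2 * h.1.2 - g.1.2 * h.2) / D, (g.1.1 * h.2 - g.2 * h.1.1) / D).

Lemma crossing_sym g h : crossing g h = crossing h g.
Proof. by rewrite /crossing -opprB oppr_eq0 [h.1.2 * _]mulrC [h.1.1 * _]mulrC. Qed.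

Lemma on_meeting_point g h p : crossing g h ->
  on g p && on h p = (p == meeting_point g h).
Proof.
rewrite /crossing /on /affine_val /meeting_point => D0.
apply/idP/eqP => [/andP[/eqP gp /eqP hp]|->/=].
  rewrite [LHS]surjective_pairing; congr pair; apply: (mulIf D0); rewrite divfK//.
    have -> : g.2 = g.1.1 * p.1 + g.1.2 * p.2 by lra.
    have -> : h.2 = h.1.1 * p.1 + h.1.2 * p.2 by lra.
    ring.
  have -> : g.2 = g.1.1 * p.1 + g.1.2 * p.2 by lra.
  have -> : h.2 = h.1.1 * p.1 + h.1.2 * p.2 by lra.
  ring.
by apply/andP; split; apply/eqP; field.
Qed.

Lemma crossing_dir0 g h d : crossing g h -> affine_dir g d = 0 ->
  affine_dir h d = 0 -> d = 0.
Proof.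
rewrite /crossing /affine_dir => D0 gd hd.
rewrite [d]surjective_pairing; congr pair; apply: (mulfI D0); rewrite mulr0.
  transitivity (h.1.2 * (g.1.1 * d.1 + g.1.2 * d.2) -
    g.1.2 * (h.1.1 * d.1 + h.1.2 * d.2)); first by ring.
  by rewrite gd hd !mulr0 subrr.
transitivity (g.1.1 * (h.1.1 * d.1 + h.1.2 * d.2) -
  h.1.1 * (g.1.1 * d.1 + g.1.2 * d.2)); first by ring.
by rewrite gd hd !mulr0 subrr.
Qed.

Definition line_dir h : R * R := (- h.1.2, h.1.1).

Lemma affine_dir_line_dir g h :
  affine_dir g (line_dir h) = - (g.1.1 * h.1.2 - g.1.2 * h.1.1).
Proof. by rewrite /affine_dir /=; ring. Qed.

Lemma affine_dir_line_dir_id h : affine_dir h (line_dir h) = 0.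
Proof. by rewrite affine_dir_line_dir mulrC subrr oppr0. Qed.

Lemma line_dir_neq0 h : proper_form h -> line_dir h != 0.
Proof.
apply: contra => /eqP[/eqP + h1]; rewrite oppr_eq0 => /eqP h2.
by rewrite [h.1]surjective_pairing h1 h2.
Qed.

(** A line parallel to both [g] and [h] would make them parallel to each other. *)
Lemma crossing_or g h k : proper_form k -> crossing g h ->
  crossing k g || crossing k h.
Proof.
move=> k0; apply: contraLR; rewrite negb_or /crossing !negbK => /andP[/eqP kg /eqP kh].
move: k0; rewrite /proper_form; case: k kg kh => -[a b] c /= kg kh ab.
have [a0|a0] := eqVneq a 0.
  have b0 : b != 0 by apply: contra ab => /eqP ->; rewrite a0.
  apply/eqP; apply: (mulfI b0); rewrite mulr0.
  have : g.1.2 * (a * h.1.2 - b * h.1.1) - h.1.2 * (a * g.1.2 - b * g.1.1) = 0.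
    by rewrite kg kh !mulr0 subrr.
  by move=> H; rewrite -[RHS]H; ring.
apply/eqP; apply: (mulfI a0); rewrite mulr0.
have : g.1.1 * (a * h.1.2 - b * h.1.1) - h.1.1 * (a * g.1.2 - b * g.1.1) = 0.
  by rewrite kg kh !mulr0 subrr.
by move=> H; rewrite -[RHS]H; ring.
Qed.

Lemma sign_choices_dir0 gs c d : c \in sign_choices gs ->
  all (fun e => affine_dir e d == 0) c = all (fun g => affine_dir g d == 0) gs.
Proof.
elim: gs c => [|g gs IHgs] c /=; first by rewrite inE => /eqP ->.
rewrite mem_cat => /orP[] /mapP[c' /IHgs <- ->] //=.
by rewrite affine_dir_opp oppr_eq0.
Qed.

(** Exactly one orientation of a form is positive at [p], unless the form vanishes there, which
    rules out both. *)
Lemma count_sign_choices p gs :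
  count (all (fun e => 0 < affine_val e p)) (sign_choices gs) =
  ~~ has (on^~ p) gs :> nat.
Proof.
elim: gs => [//|g gs IHgs] /=.
rewrite count_cat !count_map; set P := all _ in IHgs *.
have cnt (b : bool) : count (fun c => b && P c) (sign_choices gs) =
    (b * ~~ has (on^~ p) gs)%N.
  by case: b; rewrite ?mul1n// mul0n; elim: (sign_choices gs).
rewrite (eq_count (a2 := fun c => (0 < affine_val g p) && P c))//.
rewrite [X in (_ + X)%N](eq_count (a2 := fun c => (affine_val g p < 0) && P c)).
  rewrite !cnt -mulnDl negb_or /on; case: ltgtP => _ /=;
  by rewrite ?mul1n ?mul0n ?add0n ?addn0.
by move=> c /=; rewrite affine_val_opp oppr_gt0.
Qed.

Lemma count_add2 (T : eqType) (a1 a2 a3 a4 : pred T) (s : seq T) :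
  {in s, forall x, (a1 x + a2 x = a3 x + a4 x)%N} ->
  (count a1 s + count a2 s = count a3 s + count a4 s)%N.
Proof.
elim: s => [//|x s IHs] H /=; have := H _ (mem_head _ _).
by have := IHs (fun y ys => H y (@mem_behead _ (x :: s) y ys)); lia.
Qed.

(** The deletion-restriction recurrence, obtained by summing the splitting identity over all sign
    choices. *)
Lemma nbounded_cons hs gs g :
  (forall p, all (on^~ p) (g :: hs) ->
    exists2 w, all (fun h => affine_dir h w == 0) hs & affine_dir g w != 0) ->
  (forall d, all (fun h => affine_dir h d == 0) (hs ++ gs) -> d = 0) ->
  (nbounded hs (g :: gs) = nbounded hs gs + nbounded (g :: hs) gs)%N.
Proof.
move=> trans pointed; rewrite /nbounded /= count_cat !count_map.
apply: count_add2 => c cs /=; apply: nonempty_bounded_split.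
  by move=> [p /andP[pg _]]; exact: trans pg.
move=> d dh dc; apply: pointed; rewrite all_cat dh.
by rewrite -(sign_choices_dir0 _ cs).
Qed.

(** Two crossing equations leave a single point, which lies in one cell if the other forms are
    nonzero there and in none otherwise. *)
Lemma nbounded_point g h gs : crossing g h ->
  nbounded [:: g; h] gs = ~~ has (on^~ (meeting_point g h)) gs :> nat.
Proof.
move=> gh; rewrite -count_sign_choices; apply: eq_count => c.
set p := meeting_point g h.
have Cp q : cell [:: g; h] c q <-> q = p /\ all (fun e => 0 < affine_val e p) c.
  rewrite /cell /= andbT; rewrite (on_meeting_point _ gh) -/p; split.
    by move=> /andP[/eqP -> ->].
  by move=> [-> ->]; rewrite eqxx.
apply/asboolP/idP => [[[q /Cp[]]]//|pc]; split; first by exists p; apply/Cp.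
apply: recession_bounded => d /andP[/= /and3P[/eqP gd /eqP hd _] _].
exact: (crossing_dir0 gh).
Qed.

Lemma nbounded_empty g h gs : cross_if_meet g h -> ~~ crossing g h ->
  nbounded [:: g; h] gs = 0%N.
Proof.
move=> gh ngh; rewrite /nbounded -(count_pred0 (sign_choices gs)).
apply: eq_count => c; apply/asboolP => -[[p]] /andP[/and3P[pg ph _] _].
by rewrite (gh p pg ph) in ngh.
Qed.

(** * Bounded cells on a line and in the plane, by induction on the lines *)

Section Counting.
Variable U : seq (R * R).
Hypothesis Uuniq : uniq U.

Definition covers g h : Prop := forall p, on g p -> on h p -> p \in U.

Lemma sum_meet g h (P : pred (R * R)) : cross_if_meet g h -> covers g h ->
  (\sum_(p <- U) [&& on g p, on h p & P p] =
   crossing g h && P (meeting_point g h))%N.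
Proof.
move=> gh Ugh; have [cgh|ncgh] /= := boolP (crossing g h); last first.
  rewrite big1// => p _; apply/eqP; rewrite eqb0.
  by apply: contra ncgh => /and3P[gp hp _]; exact: gh hp.
set m := meeting_point g h.
have mU : m \in U.
  by have := on_meeting_point m cgh; rewrite eqxx => /andP[]; exact: Ugh.
rewrite (bigD1_seq m)//= big1 ?addn0.
  by rewrite andbA (on_meeting_point m cgh) eqxx.
by move=> p pm; rewrite andbA (on_meeting_point p cgh) (negPf pm).
Qed.

Definition nmeet h gs : nat := (\sum_(p <- U) (on h p && has (on^~ p) gs))%N.

Lemma nmeet_cons h g gs : cross_if_meet g h -> covers g h ->
  (nmeet h (g :: gs) =
   nmeet h gs + (crossing g h && ~~ has (on^~ (meeting_point g h)) gs))%N.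
Proof.
move=> gh Ugh.
rewrite -(sum_meet (fun p => ~~ has (on^~ p) gs) gh Ugh) -big_split /=.
by apply: eq_bigr => p _ /=; case: (on h p); case: (on g p); case: (has _ _).
Qed.

Lemma nmeet_gt0 h gs : (forall g, g \in gs -> covers g h) ->
  has (crossing^~ h) gs -> (0 < nmeet h gs)%N.
Proof.
move=> Ugs /hasP[g gg gh]; set m := meeting_point g h.
have /andP[gm hm] : on g m && on h m by rewrite on_meeting_point.
rewrite /nmeet (bigD1_seq m)//=; last exact: Ugs gm hm.
by rewrite hm; have -> : has (on^~ m) gs by apply/hasP; exists g.
Qed.

(** Each new vertex on the line adds one bounded edge, except the first, which only yields two rays.
    The truncated predecessor also gives 0 when there is no vertex. *)
Lemma nbounded_line h gs : proper_form h ->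
  (forall g, g \in gs -> cross_if_meet g h) ->
  (forall g, g \in gs -> covers g h) ->
  nbounded [:: h] gs = (nmeet h gs).-1.
Proof.
move=> h0; elim: gs => [|g gs IHgs] ghs Ugs.
  rewrite /nbounded /= addn0 (@nonempty_boundedF _ _ (line_dir h)).
  - by rewrite /nmeet big1// => p _; rewrite andbF.
  - by rewrite /recession /= affine_dir_line_dir_id eqxx.
  - exact: line_dir_neq0.
have gh := ghs g (mem_head _ _); have Ugh := Ugs g (mem_head _ _).
have ghs' k : k \in gs -> cross_if_meet k h by move=> kg; apply: ghs; rewrite inE kg orbT.
have Ugs' k : k \in gs -> covers k h by move=> kg; apply: Ugs; rewrite inE kg orbT.
(* A line of [gs] crossing [h] supplies the pointedness required by the recurrence. *)
rewrite nmeet_cons//; have [hc|hnc] := boolP (has (crossing^~ h) gs).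
  rewrite nbounded_cons.
  - have -> : nbounded [:: g; h] gs =
        (crossing g h && ~~ has (on^~ (meeting_point g h)) gs) :> nat.
      have [cgh|ncgh] := boolP (crossing g h); first exact: nbounded_point.
      exact: nbounded_empty.
    by rewrite IHgs//; have := nmeet_gt0 Ugs' hc; lia.
  - move=> p /and3P[pg ph _]; exists (line_dir h).
      by rewrite /= affine_dir_line_dir_id eqxx.
    by rewrite affine_dir_line_dir oppr_eq0; exact: gh pg ph.
  - move=> d /andP[/eqP hd /allP gd]; have /hasP[k kg kh] := hc.
    by apply: (crossing_dir0 kh) => //; apply/eqP; exact: gd.
(* Otherwise all of [gs] is parallel to [h]: adding [g] makes at most one vertex, and each cell on
   the line recedes along [line_dir h] or its opposite. *)
have -> : nmeet h gs = 0%N.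
  rewrite /nmeet big1// => p _; apply/eqP; rewrite eqb0; apply/negP.
  move=> /andP[hp /hasP[k kg kp]]; move/hasP: hnc; apply; exists k => //.
  exact: ghs' kp hp.
rewrite add0n; have -> : (crossing g h && ~~ has (on^~ (meeting_point g h)) gs).-1 = 0%N.
  by case: (_ && _).
have dir0 c : c \in sign_choices gs ->
    all (fun e => affine_dir e (line_dir h) == 0) c.
  move=> cs; rewrite (sign_choices_dir0 _ cs); apply/allP => k kg.
  rewrite affine_dir_line_dir oppr_eq0; apply/negPn/negP => kh.
  by move/hasP: hnc; apply; exists k.
have unb k c : c \in sign_choices gs -> nonempty_bounded [:: h] (k :: c) = false.
  move=> /dir0 /allP c0; have ld0 := line_dir_neq0 h0.
  have [kd|kd] := leP 0 (affine_dir k (line_dir h)).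
    apply: nonempty_boundedF ld0.
    rewrite /recession /= affine_dir_line_dir_id eqxx kd.
    by apply/allP => e /c0 /= /eqP ->.
  apply: (@nonempty_boundedF _ _ (-1 *: line_dir h)).
    rewrite /recession /= !affine_dirZ affine_dir_line_dir_id mulr0 eqxx.
    rewrite mulN1r oppr_ge0 (ltW kd) /=.
    by apply/allP => e /c0 /= /eqP; rewrite affine_dirZ => ->; rewrite mulr0.
  by rewrite scaler_eq0 negb_or ld0 andbT oppr_eq0 oner_eq0.
rewrite /nbounded /= count_cat !count_map.
rewrite (eq_in_count (a2 := pred0)); last by move=> c /unb /= ->.
rewrite [X in (_ + X)%N](eq_in_count (a2 := pred0)); last by move=> c /unb /= ->.
by rewrite count_pred0.
Qed.

(** Along [line_dir g] the form [g] is constant, so this direction or its opposite is a recession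
    direction of each region. *)
Lemma nbounded_two g h : proper_form g -> nbounded [::] [:: g; h] = 0%N.
Proof.
move=> g0; have ld0 := line_dir_neq0 g0.
have unb e k : affine_dir e (line_dir g) = 0 ->
    nonempty_bounded [::] [:: e; k] = false.
  move=> e0; have [kd|kd] := leP 0 (affine_dir k (line_dir g)).
    by apply: nonempty_boundedF ld0; rewrite /recession /= e0 kd lexx.
  apply: (@nonempty_boundedF _ _ (-1 *: line_dir g)).
    by rewrite /recession /= !affine_dirZ e0 mulr0 lexx mulN1r oppr_ge0 ltW.
  by rewrite scaler_eq0 negb_or ld0 andbT oppr_eq0 oner_eq0.
have g0' := affine_dir_line_dir_id g.
by rewrite /nbounded /= !unb// affine_dir_opp g0' oppr0.
Qed.

(** Lines are added in front of the crossing pair [g1], [g2], which ensures pointedness throughout.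
    A new line with [m] vertices adds [m - 1] bounded faces and 1 to the size, matching the growth
    [m] of the right side. *)
Lemma nbounded_plane gs g1 g2 gs' : gs' = gs ++ [:: g1; g2] ->
  all proper_form gs' -> crossing g1 g2 ->
  pairwise (fun g h => `[< cross_if_meet h g /\ covers h g >]) gs' ->
  (nbounded [::] gs' + size gs' =
   1 + \sum_(p <- U) (count (on^~ p) gs').-1)%N.
Proof.
move=> {gs'}-> + g12; elim: gs => [|g gs IHgs].
  move=> /= /and3P[g10 g20 _] /andP[/andP[/asboolP[g1g2 U12] _] _].
  rewrite nbounded_two// add0n.
  have := sum_meet predT g1g2 U12; rewrite crossing_sym g12 /= => sum1.
  suff -> : (\sum_(p <- U) (on g1 p + (on g2 p + 0)).-1 = 1)%N by [].
  rewrite -[RHS]sum1; apply: eq_bigr => p _.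
  by case: (on g1 p); case: (on g2 p).
rewrite cat_cons; set gs' := gs ++ _ in IHgs *.
move=> /= /andP[g0 gs0] /andP[/allP gp gsp].
have := IHgs gs0 gsp.
have gc : has (crossing^~ g) gs'.
  rewrite has_cat; apply/orP; right; rewrite /= orbF.
  by rewrite !(crossing_sym _ g); exact: crossing_or.
have gsc h : h \in gs' -> cross_if_meet h g by move=> /gp/asboolP[].
have gsU h : h \in gs' -> covers h g by move=> /gp/asboolP[].
rewrite nbounded_cons; last 2 first.
(* The gradient of [g] is transversal to its line: its slope is a nonzero sum of squares. *)
- move=> p _; exists g.1 => //; rewrite /affine_dir.
  move: g0; rewrite /proper_form; case: g.1 => a b /= ab.
  rewrite -!expr2 paddr_eq0 ?sqr_ge0// !sqrf_eq0; apply: contra ab.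
  by move=> /andP[/eqP -> /eqP ->].
- move=> d /allP gd; have /andP[g1s g2s] : (g1 \in gs') && (g2 \in gs').
    by rewrite !mem_cat !inE !eqxx !orbT.
  by apply: (crossing_dir0 g12); apply/eqP; exact: gd.
rewrite nbounded_line//.
(* A point of [g] raises its summand only if an earlier line already passes through it. *)
have -> : (\sum_(p <- U) (on g p + count (on^~ p) gs').-1 =
    \sum_(p <- U) (count (on^~ p) gs').-1 + nmeet g gs')%N.
  rewrite -big_split /=; apply: eq_bigr => p _; rewrite has_count.
  by case: (on g p); case: (count _ _) => //= m; rewrite ?addn1 ?addn0.
by have := nmeet_gt0 gsU gc; lia.
Qed.

End Counting.

(** * Cells as connected components *)

Lemma cell_segment hs c p q t : cell hs c p -> cell hs c q -> 0 <= t <= 1 ->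
  cell hs c (p + t *: (q - p)).
Proof.
move=> /andP[/allP ph /allP pc] /andP[/allP qh /allP qc] /andP[t0 t1].
apply/andP; split; apply/allP => e es; rewrite affine_val_segment.
  by rewrite (eqP (ph _ es)) (eqP (qh _ es)) !mulr0 addr0.
have := pc _ es; have := qc _ es => /= ? ?; nra.
Qed.

(** The image of [D] under the form is an interval that avoids 0. *)
Lemma connected_affine_sign (D : set (R * R)) e p q : connected D ->
  (forall x, D x -> affine_val e x != 0) -> D p -> D q ->
  0 < affine_val e p -> 0 < affine_val e q.
Proof.
move=> Dc D0 Dp Dq ep; rewrite lt_def D0//= leNgt; apply/negP => eq.
have : connected (affine_val e @` D).
  apply: connected_continuous_connected => //.
  exact/continuous_subspaceT/affine_val_continuous.
move=> /connected_intervalP.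
move=> /(_ (affine_val e q) (affine_val e p)).
move=> /(_ (ex_intro2 _ _ q Dq erefl) (ex_intro2 _ _ p Dp erefl) 0).
by rewrite (ltW eq) (ltW ep) => /(_ erefl)[x Dx /eqP]; rewrite (negPf (D0 _ Dx)).
Qed.

(** With [hs] empty this is the complement of the lines, with one form a line minus the others. *)
Definition stratum hs gs : set (R * R) :=
  [set p | all (on^~ p) hs && ~~ has (on^~ p) gs].

Lemma cell_stratum hs gs c p : c \in sign_choices gs -> cell hs c p ->
  stratum hs gs p.
Proof.
move=> cs /andP[ph pc]; apply/andP; split=> //.
suff : (0 < count (all (fun e => 0 < affine_val e p)%R) (sign_choices gs))%N.
  by rewrite count_sign_choices lt0b.
by rewrite -has_count; apply/hasP; exists c.
Qed.

Lemma stratum_cell hs gs p : stratum hs gs p ->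
  exists2 c, c \in sign_choices gs & cell hs c p.
Proof.
move=> /andP[ph pg]; have : (0 < ~~ has (on^~ p) gs)%N by rewrite pg.
rewrite -count_sign_choices -has_count => /hasP[c cs pc].
by exists c => //; apply/andP.
Qed.

Lemma sign_choices_sign gs c e : c \in sign_choices gs -> e \in c ->
  exists2 g, g \in gs & e = g \/ e = affine_opp g.
Proof.
elim: gs c => [|g gs IHgs] c /=; first by rewrite inE => /eqP ->.
rewrite mem_cat => /orP[] /mapP[c' c's ->]; rewrite inE => /orP[/eqP ->|ec'].
- by exists g; [exact: mem_head|left].
- by have [k kg ek] := IHgs _ c's ec'; exists k => //; rewrite inE kg orbT.
- by exists g; [exact: mem_head|right].
- by have [k kg ek] := IHgs _ c's ec'; exists k => //; rewrite inE kg orbT.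
Qed.

(** Signs are constant on connected subsets of the stratum; conversely a cell is convex, so segments
    connect its points. *)
Lemma component_cell hs gs c p : c \in sign_choices gs -> cell hs c p ->
  connected_component (stratum hs gs) p = cell hs c.
Proof.
move=> cs Cp; apply/seteqP; split => q.
  move=> [D [Dp DX Dc] Dq]; have /andP[qh _] := DX _ Dq.
  apply/andP; split => //; apply/allP => e ec.
  apply: (connected_affine_sign Dc _ Dp Dq); last first.
    by move: Cp => /andP[_ /allP]; apply.
  move=> x /DX /andP[_ /hasPn xg].
  have [g /xg gx [->//|->]] := sign_choices_sign cs ec.
  by rewrite affine_val_opp oppr_eq0.
move=> Cq; pose f (t : R) : R * R := p + t *: (q - p).
exists (f @` `[0, 1]); last first.
  by exists 1; rewrite ?/f ?scale1r ?subrKC//= in_itv/= lexx ler01.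
split.
- by exists 0; rewrite ?/f ?scale0r ?addr0//= in_itv/= lexx ler01.
- move=> _ [t /= + <-]; rewrite in_itv/= => t01.
  by apply: (cell_stratum cs); exact: cell_segment.
- apply: connected_continuous_connected; first exact: segment_connected.
  apply: continuous_subspaceT => t.
  by apply: cvgD; [exact: cvg_cst|apply: cvgZr_tmp; exact: cvg_id].
Qed.

Lemma ncard_seq (T : choiceType) (s : seq T) : uniq s -> ncard [set` s] = size s.
Proof.
move=> us; rewrite /ncard.
have -> : [set` s] = [set` [fset x in s]%fset].
  by apply/seteqP; split => x /=; rewrite inE.
by rewrite set_fsetK card_fseq undup_id.
Qed.

Lemma nbounded_components hs gs :
  ncard (components (stratum hs gs) `&` bounded_set) = nbounded hs gs.
Proof.
pose s := [seq cell hs c | c <- sign_choices gs & nonempty_bounded hs c].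
have -> : components (stratum hs gs) `&` bounded_set = [set` s].
  apply/seteqP; split => [_ [[p Xp <-]] /= Cb|_ /= /mapP[c + ->]].
    have [c cs Cp] := stratum_cell Xp; apply/mapP; exists c.
      rewrite mem_filter cs andbT; apply/asboolP; split; first by exists p.
      by rewrite -(component_cell cs Cp).
    exact: component_cell.
  rewrite mem_filter => /andP[/asboolP[[p Cp] Cb] cs]; split => //.
  exists p; first exact: cell_stratum Cp.
  exact: component_cell.
rewrite ncard_seq ?size_map ?size_filter//.
apply: count_mem_uniq => Y; have [Ys|/count_memPn//] := boolP (Y \in s).
apply/eqP; rewrite eqn_leq -has_count has_pred1 Ys andbT.
have /mapP[c] := Ys; rewrite mem_filter => /andP[/asboolP[[p Cp] Cb] cs] YE.
(* A point of the cell determines all signs, so different sign choices do not repeat a nonempty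
   cell. *)
have := leq_b1 (~~ has (on^~ p) gs); rewrite -count_sign_choices.
apply: leq_trans; rewrite /s count_map count_filter; apply: sub_count => c' /=.
move=> /andP[/eqP c'Y _]; have : cell hs c' p by rewrite c'Y YE.
by move=> /andP[].
Qed.

End Cells.

Arguments on {R} g p.

(** * Point multiplicities for a finite list of lines *)

Section Incidences.
Variable K : fieldType.
Implicit Types (A : set (set (K * K))) (s : seq (set (K * K))) (p : K * K).

Definition nlines s p : nat := count (fun l => `[< l p >]) s.

Lemma card_eq_seq (T : choiceType) (s : seq T) n : uniq s ->
  [set` s] #= `I_n <-> size s = n.
Proof.
move=> us; split=> [sn|<-]; first by rewrite -(ncard_seq us) /ncard (card_fset_set sn).
have -> : [set` s] = [set` [fset x in s]%fset].
  by apply/seteqP; split => x /=; rewrite inE.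
by apply/card_eq_fsetP; rewrite card_fseq undup_id.
Qed.

Lemma finite_set_seq (T : choiceType) (A : set T) : finite_set A ->
  exists2 s, uniq s & A = [set` s].
Proof.
move=> Af; exists (enum_fset (fset_set A)); first exact: fset_uniq.
by rewrite -[LHS]fset_setK.
Qed.

Lemma points_on_seq s i : uniq s -> points_on i [set` s] = [set p | nlines s p = i].
Proof.
move=> us; apply/seteqP; suff E p : points_on i [set` s] p <-> nlines s p = i.
  by split => p /E.
rewrite /nlines -size_filter -(card_eq_seq _ (filter_uniq _ us)) /points_on /=.
suff -> : [set l | l \in s /\ l p] = [set` [seq l <- s | `[< l p >]]] by [].
apply/seteqP; split => l /=; rewrite mem_filter.
  by move=> [-> lp]; rewrite andbT; apply/asboolP.
by move=> /andP[/asboolP].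
Qed.

Lemma x_seq s i (U : seq (K * K)) : uniq s -> uniq U ->
  (forall p, nlines s p = i -> p \in U) ->
  x_ i [set` s] = count (fun p => nlines s p == i) U.
Proof.
move=> us uU iU; rewrite /x_ points_on_seq// -size_filter -ncard_seq ?filter_uniq//.
congr ncard; apply/seteqP; split => p /=; rewrite mem_filter.
  by move=> pi; rewrite pi eqxx iU.
by move=> /andP[/eqP].
Qed.

(** After exchanging the sums, each point contributes only at its own multiplicity, which is at most
    [size s]. Constant 1 and identity weights count points and incidences. *)
Lemma sum_x_seq s (U : seq (K * K)) (phi : nat -> nat) : uniq s -> uniq U ->
  (forall p, (2 <= nlines s p)%N -> p \in U) ->
  (\sum_(2 <= i < (size s).+1) phi i * x_ i [set` s] =
   \sum_(p <- U | 2 <= nlines s p) phi (nlines s p))%N.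
Proof.
move=> us uU U2.
transitivity (\sum_(2 <= i < (size s).+1) \sum_(p <- U)
    (phi i * (nlines s p == i)))%N.
  apply: eq_big_nat => i /andP[i2 _]; rewrite (x_seq us uU) => [|p pi].
    by rewrite -sum1_count big_mkcond big_distrr.
  by apply: U2; rewrite pi.
rewrite exchange_big /= [RHS]big_mkcond /=; apply: eq_bigr => p _.
have ps : (nlines s p <= size s)%N by exact: count_size.
case: ifPn => p2; last first.
  rewrite big_nat_cond big1// => i /andP[/andP[i2 _] _].
  by case: eqVneq => [pi|]; [rewrite pi i2 in p2|rewrite muln0].
rewrite (bigD1_seq (nlines s p)) ?iota_uniq//=; last first.
  by rewrite mem_index_iota p2 ltnS.
rewrite eqxx muln1 big1 ?addn0// => i; rewrite eq_sym => /negPf ->.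
by rewrite muln0.
Qed.

End Incidences.

(** * Counting points and incidences over a finite field *)

Section FiniteField.
Variable K : finFieldType.
Implicit Types (s : seq (set (K * K))).

(** If [b] is zero the equation fixes the first coordinate and leaves the second free; otherwise
    each first coordinate determines the second. *)
Lemma card_line (l : set (K * K)) : is_line l ->
  (\sum_(p : K * K) `[< l p >] = #|K|)%N.
Proof.
move=> [a [b [c [ab ->]]]].
rewrite (eq_bigr (fun p : K * K => (a * p.1 + b * p.2 == c) : nat)); last first.
  by move=> p _; congr nat_of_bool; apply/asboolP/eqP.
rewrite -(pair_bigA _ (fun x y => (a * x + b * y == c) : nat)) /=.
have one (d : K) : (\sum_(x : K) (x == d) = 1)%N.
  by rewrite (bigD1 d)//= eqxx big1// => x /negPf ->.
have [b0|b0] := eqVneq b 0.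
  have a0 : a != 0 by apply/eqP => a0; apply: ab; rewrite a0 b0.
  rewrite exchange_big /= -sum1_card; apply: eq_bigr => y _.
  rewrite -(one (c / a)); apply: eq_bigr => x _.
  congr nat_of_bool; rewrite b0 mul0r addr0 -[RHS](inj_eq (mulfI a0)).
  by rewrite [in RHS]mulrCA divff// mulr1.
rewrite -sum1_card; apply: eq_bigr => x _.
rewrite -(one ((c - a * x) / b)); apply: eq_bigr => y _.
congr nat_of_bool; rewrite -[RHS](inj_eq (mulfI b0)) [in RHS]mulrCA divff// mulr1.
by rewrite [RHS]eq_sym subr_eq [RHS]eq_sym addrC.
Qed.

(** Incidences are counted by points and then by lines, each of the [q + 1] lines having [q] points;
    the second identity counts the plane. *)
Lemma finite_field_incidences s (q := #|K|) : uniq s -> size s = q.+1 ->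
  [set` s] `<=` @is_line K ->
  (x_ 1 [set` s] + \sum_(2 <= i < q.+2) i * x_ i [set` s] = q * q.+1)%N /\
  (x_ 0 [set` s] + x_ 1 [set` s] + \sum_(2 <= i < q.+2) x_ i [set` s] = q * q)%N.
Proof.
move=> us sq sl; pose U := enum {: K * K}.
have uU : uniq U by exact: enum_uniq.
have inU p : p \in U by rewrite mem_enum.
have x1 := x_seq us uU (fun p (_ : nlines s p = 1%N) => inU p).
have x0 := x_seq us uU (fun p (_ : nlines s p = 0%N) => inU p).
have sumx phi := sum_x_seq phi us uU (fun p _ => inU p).
rewrite sq in sumx.
have E : (\sum_(2 <= i < q.+2) x_ i [set` s] =
          \sum_(2 <= i < q.+2) (fun=> 1) i * x_ i [set` s])%N.
  by apply: eq_bigr => i _; rewrite mul1n.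
rewrite E !sumx x0 x1 -!sum1_count; split.
  transitivity (\sum_(p <- U) nlines s p)%N.
    rewrite [X in (X + _)%N]big_mkcond [X in (_ + X)%N]big_mkcond /=.
    rewrite -big_split; apply: eq_bigr => p _ /=.
    by case: (nlines s p) => [|[|m]].
  rewrite /nlines; under eq_bigr do rewrite -sum1_count big_mkcond /=.
  rewrite exchange_big /= mulnC -sq -sum1_size big_distrl /=.
  rewrite big_seq [RHS]big_seq; apply: eq_bigr => l ls.
  rewrite mul1n /q -(card_line (sl _ ls)) /U big_enum /=; apply: eq_bigr => p _.
  by case: asboolP.
transitivity (\sum_(p <- U) 1)%N.
  rewrite [X in (X + _ + _)%N]big_mkcond [X in (_ + X + _)%N]big_mkcond.
  rewrite [X in (_ + X)%N]big_mkcond /=.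
  rewrite -!big_split; apply: eq_bigr => p _ /=.
  by case: (nlines s p) => [|[|m]].
by rewrite sum1_size -cardE card_prod.
Qed.

End FiniteField.

(** * Cardinality of disjoint unions *)

Lemma ncardU (T : choiceType) (A B : set T) : finite_set A -> finite_set B ->
  A `&` B = set0 -> ncard (A `|` B) = (ncard A + ncard B)%N.
Proof.
move=> Af Bf AB; rewrite /ncard fset_setU//.
by rewrite cardfsU -fset_setI// AB fset_set0 cardfs0 subn0.
Qed.

Lemma ncard_bigcup (I : eqType) (T : choiceType) (s : seq I) (F : I -> set T) :
  uniq s -> {in s, forall i, finite_set (F i)} ->
  {in s &, forall i j, i != j -> F i `&` F j = set0} ->
  ncard (\bigcup_(i in [set` s]) F i) = (\sum_(i <- s) ncard (F i))%N.
Proof.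
elim: s => [_ _ _|i s IHs /= /andP[ni us] Ff Fd].
  have -> : [set` [::]] = set0 :> set I by apply/seteqP; split.
  by rewrite bigcup_set0 big_nil /ncard fset_set0 cardfs0.
have -> : [set` i :: s] = i |` [set` s].
  by apply/seteqP; split => j /=; rewrite inE => /predU1P.
have js j : j \in s -> j \in i :: s by move=> ?; rewrite inE orbC; apply/orP; left.
rewrite bigcup_setU1 big_cons ncardU ?IHs//.
- by move=> j /js /Ff.
- by move=> j k /js js' /js ks'; exact: Fd.
- by apply: Ff; exact: mem_head.
- by apply: bigcup_finite => [|j /= /js /Ff//]; exact: finite_seq.
- apply/seteqP; split => // x [Fx [j /= jE Fjx]].
  have ij : i != j by apply: contraNneq ni => ->.
  by have /seteqP[/(_ x (conj Fx Fjx))] := Fd i j (mem_head _ _) (js _ jE) ij.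
Qed.

(** * Bounded edges and faces of a real arrangement *)

Section RealArrangement.
Variable R : realType.
Implicit Types (A : set (set (R * R))) (p : R * R) (g h : R * R * R).

(** The linear parts are proportional, so a displacement from [p] along one line is also along the
    other. *)
Lemma noncrossing_eq g h p : proper_form g -> proper_form h -> ~~ crossing g h ->
  on g p -> on h p -> on g =1 on h.
Proof.
have sub g' h' q : proper_form g' -> ~~ crossing g' h' -> on g' p -> on h' p ->
    on g' q -> on h' q.
  rewrite /proper_form /crossing negbK /on => g0 /eqP gh /eqP gp /eqP hp /eqP gq.
  have dg : affine_dir g' (q - p) = 0.
    have := affine_val_move g' p (q - p) 1.
    by rewrite scale1r addrC subrK gp gq mul1r add0r.
  have := affine_val_move h' p (q - p) 1.
  rewrite scale1r addrC subrK hp mul1r add0r => ->; move: g0 gh dg.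
  rewrite /affine_dir; case: (q - p) => x y; case: g' {gp gq} => -[a b] c /=.
  case: h' {hp} => -[a' b'] c' /= ab gh dg.
  have [a0|a0] := eqVneq a 0.
    have b0 : b != 0 by apply: contra ab => /eqP ->; rewrite a0.
    move/eqP: gh; rewrite a0 mul0r sub0r oppr_eq0 mulf_eq0 (negPf b0) => /eqP ->.
    move/eqP: dg; rewrite a0 mul0r add0r mulf_eq0 (negPf b0) => /eqP ->.
    by rewrite mulr0 addr0.
  apply/eqP; apply: (mulfI a0); rewrite mulr0.
  have : y * (a * b' - b * a') + a' * (a * x + b * y) = 0.
    by rewrite gh dg !mulr0 addr0.
  by move=> H; rewrite -[RHS]H; ring.
move=> g0 h0 gh gp hp q; apply/idP/idP; apply: sub => //.
by rewrite crossing_sym.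
Qed.

Lemma vertices_nlines (s : seq (set (R * R))) p : uniq s ->
  vertices [set` s] p <-> (2 <= nlines s p)%N.
Proof.
move=> us; rewrite /nlines -size_filter; set t := [seq l <- s | _].
have tP l : l \in t <-> l \in s /\ l p.
  by rewrite mem_filter andbC; split => [/andP[? /asboolP]//|[-> /asboolP]].
split=> [[l [m [ls ms lm lp mp]]]|].
  rewrite -[2%N]/(size [:: l; m]); apply: uniq_leq_size.
    by rewrite /= inE andbT; exact/eqP.
  by move=> k; rewrite !inE => /orP[] /eqP ->; apply/tP.
case: t (filter_uniq (fun l => `[< l p >]) us : uniq t) tP => [|l [|m t]]//=.
rewrite inE negb_or => /andP[/andP[/eqP lm _] _] tP _.
have /tP[ls lp] : l \in [:: l, m & t] by rewrite inE eqxx.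
have /tP[ms mp] : m \in [:: l, m & t] by rewrite !inE eqxx orbT.
by exists l, m.
Qed.

(** Edges are counted line by line, faces by [nbounded_plane]. Additive forms avoid truncated
    subtraction. *)
Lemma bounded_cells_count n A : arrangement n A -> vertices A !=set0 ->
  (f1b A + n = \sum_(2 <= i < n.+1) i * x_ i A)%N /\
  (f2b A + n + \sum_(2 <= i < n.+1) x_ i A =
   1 + \sum_(2 <= i < n.+1) i * x_ i A)%N.
Proof.
move=> An [p0 [l1 [l2 [Al1 Al2 l12 p0l1 p0l2]]]]; have [Acard Al] := An.
have [U uU UE] := finite_set_seq (vertices_finite An).
(* Two lines through a vertex are put last, as [nbounded_plane] expects. *)
have [s us sE] : exists2 s, uniq (s ++ [:: l1; l2]) & A = [set` s ++ [:: l1; l2]].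
  have [s us sE] : exists2 s, uniq s & A = [set` s].
    by apply: finite_set_seq; exists n.
  exists [seq l <- s | l \notin [:: l1; l2]].
    rewrite cat_uniq filter_uniq// andTb; apply/andP; split.
      by apply/hasPn => l ll; rewrite /= mem_filter ll.
    by rewrite /= inE andbT; exact/eqP.
  rewrite sE; apply/seteqP; split => l /=; rewrite mem_cat mem_filter.
    by move=> ->; rewrite andbT orNb.
  move=> /orP[/andP[]//|]; rewrite !inE => /orP[] /eqP ->.
    by have : A l1 by []; rewrite sE.
  by have : A l2 by []; rewrite sE.
move: us sE; set s' := s ++ _ => us sE.
have sn : size s' = n by apply/card_eq_seq => //; rewrite -sE.
have Als l : l \in s' <-> A l by rewrite sE.
have [f fP] : exists f : set (R * R) -> R * R * R, forall l, l \in s' ->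
    proper_form (f l) /\ l = [set p | on (f l) p].
  suff : forall l, exists g, l \in s' -> proper_form g /\ l = [set p | on g p].
    by move=> /boolp.choice[f fP]; exists f.
  move=> l; have [/Als/Al|?] := boolP (l \in s'); last by exists (0, 0, 0).
  move=> [a [b [c [ab ->]]]]; exists (a, b, c) => _; split; first exact/eqP.
  apply/seteqP; split => p; rewrite /on /affine_val /=.
    by move=> ->; rewrite subrr.
  by rewrite subr_eq0 => /eqP.
have onE l p : l \in s' -> on (f l) p <-> l p.
  by move=> /fP[_ lE]; rewrite {2}lE.
have onb l p : l \in s' -> on (f l) p = `[< l p >].
  by move=> ls; apply/idP/asboolP => /(onE _ _ ls).
have cim l m : l \in s' -> m \in s' -> l != m -> cross_if_meet (f l) (f m).
  move=> ls ms /eqP lm p lp mp; apply: contraT => nc; exfalso; apply: lm.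
  have [fl0 ->] := fP _ ls; have [fm0 ->] := fP _ ms.
  by apply/seteqP; split => q /=; rewrite (noncrossing_eq fl0 fm0 nc lp mp).
have cov l m : l \in s' -> m \in s' -> l != m -> covers U (f l) (f m).
  move=> ls ms lm p /(onE _ _ ls) lp /(onE _ _ ms) mp.
  suff : vertices A p by rewrite UE.
  by exists l, m; split => //; [exact/Als|exact/Als|exact/eqP].
have nlinesE p : nlines s' p = count (on^~ p) (map f s').
  by rewrite count_map; apply: eq_in_count => l ls /=; rewrite onb.
have U2 p : (2 <= nlines s' p)%N = (p \in U).
  apply/idP/idP => [/(vertices_nlines _ us)|pU]; first by rewrite -sE UE.
  by apply/(vertices_nlines _ us); rewrite -sE UE.
have sumx phi : (\sum_(2 <= i < n.+1) phi i * x_ i A =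
    \sum_(p <- U) phi (nlines s' p))%N.
  rewrite -sn sE (sum_x_seq _ us uU); last by move=> p; rewrite U2.
  rewrite [LHS]big_seq_cond [RHS]big_seq; apply: eq_bigl => p.
  by rewrite U2 andbb.
have S0 : (\sum_(2 <= i < n.+1) x_ i A = size U)%N.
  rewrite -sum1_size -(sumx (fun=> 1%N)).
  by apply: eq_bigr => i _; rewrite mul1n.
rewrite S0 (sumx id) /=.
have l1s : l1 \in s' by exact/Als. have l2s : l2 \in s' by exact/Als.
have cr12 : crossing (f l1) (f l2).
  by apply: (cim _ _ l1s l2s _ p0); [exact/eqP|exact/onE|exact/onE].
split.
  have restE l : l \in s' -> l `\` vertices A =
      stratum [:: f l] (map f (rem l s')).
    move=> ls; apply/seteqP; split => p.
      move=> [lp nv]; apply/andP; split; first by rewrite /= andbT; exact/onE.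
      apply/hasP => -[k /mapP[m + ->]]; rewrite mem_rem_uniq// inE.
      move=> /andP[ml ms] /(onE _ _ ms) mp; apply: nv; exists l, m.
      by split; [exact/Als|exact/Als|apply/eqP; rewrite eq_sym|..].
    move=> /andP[/andP[/(onE _ _ ls) lp _] /hasPn nm]; split => //.
    move=> [m [m' [/Als ms /Als ms' mm' mp mp']]].
    have other k : k \in s' -> k p -> k = l.
      move=> ks kp; apply/eqP; apply: contraT => kl.
      have kr : k \in rem l s' by rewrite mem_rem_uniq// inE kl.
      have := nm _ (map_f f kr).
      by have -> : on (f k) p by exact/onE.
    by apply: mm'; rewrite (other m)// (other m').
  have f1E l : l \in s' -> (ncard (components (l `\` vertices A) `&` bounded_set)
      + 1 = \sum_(p <- U) `[< l p >])%N.
    move=> ls; rewrite restE// nbounded_components.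
    have ms m : m \in rem l s' -> m \in s' /\ m != l.
      by rewrite mem_rem_uniq// inE => /andP[].
    have [fl0 _] := fP _ ls.
    have lcov g : g \in map f (rem l s') -> covers U g (f l).
      by move=> /mapP[m /ms[ms' ml] ->]; exact: cov.
    rewrite (nbounded_line uU fl0)//; last first.
      by move=> g /mapP[m /ms[ms' ml] ->]; exact: cim.
    (* The predecessor is not truncated: [l] crosses [l1] or [l2], hence carries a vertex. *)
    rewrite addn1 prednK; last first.
      apply: nmeet_gt0 => //; rewrite has_map; apply/hasP.
      have /orP[lc|lc] := crossing_or fl0 cr12.
        exists l1; last by rewrite /= crossing_sym.
        rewrite mem_rem_uniq// inE l1s andbT; apply: contraTneq lc => ->.
        by rewrite /crossing mulrC subrr eqxx.
      exists l2; last by rewrite /= crossing_sym.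
      rewrite mem_rem_uniq// inE l2s andbT; apply: contraTneq lc => ->.
      by rewrite /crossing mulrC subrr eqxx.
    rewrite /nmeet [LHS]big_seq [RHS]big_seq; apply: eq_bigr => p pU.
    rewrite onb//; case: asboolP => //= lp.
    suff -> : has (on^~ p) [seq f i | i <- rem l s'] by [].
    have : vertices A p by rewrite UE.
    move=> [m [m' [/Als ms1 /Als ms1' mm' mp mp']]]; rewrite has_map; apply/hasP.
    have [ml|ml] := eqVneq m l; [exists m'|exists m]; rewrite /= ?onb//;
      try exact/asboolP; rewrite mem_rem_uniq// inE ?ms1 ?ms1' ?ml ?andbT//.
    by apply/eqP => m'l; apply: mm'; rewrite ml m'l.
  have -> : f1b A = (\sum_(l <- s')
      ncard (components (l `\` vertices A) `&` bounded_set))%N.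
    rewrite /f1b /edges setI_bigcupl {1}sE ncard_bigcup//.
      move=> l ls; apply: sub_finite_set (edges_finite An) => C [lC _].
      by exists l => //; exact/Als.
    (* An edge shared by two lines would contain a point of both, that is, a vertex, but vertices
       are removed. *)
    move=> l m ls ms /eqP lm; apply/seteqP; split => // C [[[p lp <-] _] [[q mq]]].
    have pC := connected_component_refl lp.
    move=> qE _; case: lp => lp nv; apply: nv.
    have : connected_component (m `\` vertices A) q p by rewrite qE.
    move=> /connected_component_sub [mp _].
    by exists l, m; split => //; exact/Als.
  rewrite -sn -sum1_size -big_split /=.
  transitivity (\sum_(l <- s') \sum_(p <- U) `[< l p >])%N.
    by rewrite [LHS]big_seq [RHS]big_seq; apply: eq_bigr => l ls; rewrite f1E.
  rewrite exchange_big /=; apply: eq_bigr => p _.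
  by rewrite /nlines -sum1_count [RHS]big_mkcond /=; apply: eq_bigr => l _; case: asboolP.
have -> : f2b A = nbounded [::] (map f s').
  rewrite -nbounded_components /f2b /faces; congr (ncard (components _ `&` _)).
  apply/seteqP; split => p.
    move=> np; apply/andP; split => //; apply/hasP => -[_ /mapP[l ls ->]].
    by move=> /(onE _ _ ls) lp; apply: np; exists l => //; exact/Als.
  move=> /andP[_ /hasPn np] [l /Als ls /(onE _ _ ls) lp].
  by have /negP := np _ (map_f f ls); apply.
have -> : (\sum_(p <- U) nlines s' p =
    size U + \sum_(p <- U) (count (on^~ p) (map f s')).-1)%N.
  rewrite -sum1_size -big_split [LHS]big_seq [RHS]big_seq; apply: eq_bigr => p pU /=.
  by rewrite -nlinesE; move: pU; rewrite -U2; lia.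
have fs0 : all (@proper_form R) (map f s').
  by apply/allP => _ /mapP[l /fP[? _] ->].
have fsp : pairwise (fun g h => `[< cross_if_meet h g /\ covers U h g >]) (map f s').
  rewrite pairwise_map; move: us; rewrite uniq_pairwise.
  apply: (@sub_in_pairwise _ (mem s')); last exact/allP.
  move=> l m ls ms /= lm; apply/asboolP; rewrite eq_sym in lm.
  by split; [exact: cim|exact: cov].
have := nbounded_plane uU (map_cat f s [:: l1; l2]) fs0 cr12 fsp.
rewrite size_map sn => nbE.
by rewrite [RHS]addnCA [LHS]addnC; congr addn; exact: nbE.
Qed.

End RealArrangement.

Theorem theorem1 (R : realType) (q p k : nat) (hp : prime p) (hk : (0 < k)%N)
    (hq : q = (p ^ k)%N) (Fq : finFieldType) (hFq : #|Fq| = q)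
    (F : set (set (Fq * Fq))) (hF : arrangement q.+1 F)
    (A : set (set (R * R))) (hA : arrangement q.+1 A)
    (hx : forall i : nat, (2 <= i <= q.+1)%N -> x_ i A = x_ i F) :
  (f1b A)%:Z = (q%:Z + 1) * (q%:Z - 1) - (x_ 1 F)%:Z /\ f2b A = x_ 0 F.
Proof.
have [Fcard Fl] := hF.
have [s us sE] : exists2 s, uniq s & F = [set` s].
  by apply: finite_set_seq; exists q.+1.
have [] : (x_ 1 F + \sum_(2 <= i < q.+2) i * x_ i F = q * q.+1)%N /\
    (x_ 0 F + x_ 1 F + \sum_(2 <= i < q.+2) x_ i F = q * q)%N.
  rewrite sE -hFq; apply: finite_field_incidences => //; last by rewrite -sE.
  by rewrite hFq; apply/card_eq_seq => //; rewrite -sE.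
have -> : (\sum_(2 <= i < q.+2) i * x_ i F = \sum_(2 <= i < q.+2) i * x_ i A)%N.
  by apply: eq_big_nat => i i2; rewrite hx.
have -> : (\sum_(2 <= i < q.+2) x_ i F = \sum_(2 <= i < q.+2) x_ i A)%N.
  by apply: eq_big_nat => i i2; rewrite hx.
have q0 : (0 < q)%N by rewrite hq expn_gt0 prime_gt0.
move=> F1 F0.
(* Otherwise A has no multiple points, and then neither has F: its q + 1 lines
   would cover q (q + 1) > q^2 points. *)
have A0 : vertices A !=set0.
  apply/set0P/negP => /eqP v0.
  have xA i : (2 <= i)%N -> x_ i A = 0%N.
    move=> i2; rewrite /x_.
    suff -> : points_on i A = set0 by rewrite /ncard fset_set0 cardfs0.
    have [t ut tE] : exists2 t, uniq t & A = [set` t].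
      by apply: finite_set_seq; have [? _] := hA; exists q.+1.
    apply/seteqP; split => // x; rewrite tE points_on_seq//= /nlines => xi.
    have : vertices A x.
      by rewrite tE; apply/(vertices_nlines _ ut); rewrite /nlines xi.
    by rewrite v0.
  have S1 : (\sum_(2 <= i < q.+2) i * x_ i A = 0)%N.
    by rewrite big_nat_cond big1// => i /andP[/andP[i2 _] _]; rewrite xA// muln0.
  by move: F1 F0; rewrite S1; nia.
(* With [q (q + 1) - x_1] incidences at the vertices and [q^2 - x_0 - x_1] vertices, subtracting
   [q + 1] from the former gives [f1b A]; subtracting [q] and the number of vertices gives
   [f2b A]. *)
have [] := bounded_cells_count hA A0.
by split; nia.
Qed.
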